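(* Let $\alpha>0$, $A\ge0$, $B>0$, $t>0$, and let $P_n(x,t)=x^n+\mathsf{p}_1(n,t)x^{n-1}+\cdots$ be the monic polynomials orthogonal on $[0,\infty)$ w.r.t. $w(x,t)=x^\alpha e^{-x}(A+B\theta(x-t))$, with norms $h_n(t)$. Let $D_n(t)=\prod_{j=0}^{n-1}h_j(t)=\det\left(\int_0^\infty x^{i+j}w(x,t)dx\right)_{i,j=0}^{n-1}$ and $R_n(t)=Bt^\alpha e^{-t}\{P_n(t,t)\}^2/h_n(t)$. Then for $n\ge1$ $$-t\frac{d}{dt}\ln D_n(t)=-t\sum_{j=0}^{n-1}\frac{d}{dt}\ln h_j(t)=t\sum_{j=0}^{n-1}R_j(t)=-\mathsf{p}_1(n,t)-n(n+\alpha).$$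
   Context: $\theta$ is the Heaviside function ($1$ for $x>0$, $0$ otherwise); $P_n(t,t)$ is $P_n(x,t)$ at $x=t$. *)

(* Defs.v *)
From HB Require Import structures.
From mathcomp Require Import all_boot all_order all_algebra.
From mathcomp Require Import all_classical all_reals all_analysis.
Set Implicit Arguments. Unset Strict Implicit. Unset Printing Implicit Defensive.
Import Order.TTheory GRing.Theory Num.Theory.
Import numFieldNormedType.Exports.
Local Open Scope classical_set_scope.
Local Open Scope ring_scope.

Definition heaviside {R : realType} (x : R) : R := if 0 < x then 1 else 0.

Definition weight {R : realType} (alpha A B t x : R) : R :=
  x `^ alpha * expR (- x) * (A + B * heaviside (x - t)).

Definition int0oo {R : realType} (f : R -> R) : R :=
  Rintegral lebesgue_measure `[0%R, +oo[ f.

Definition moment {R : realType} (alpha A B t : R) (k : nat) : R :=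
  int0oo (fun x => x ^+ k * weight alpha A B t x).

Definition hankelD {R : realType} (alpha A B t : R) (n : nat) : R :=
  \det (\matrix_(i < n, j < n) moment alpha A B t (i + j)%N).

Definition monic_orthogonal_family {R : realType} (alpha A B : R)
    (P : R -> nat -> {poly R}) : Prop :=
  forall s : R, 0 < s -> forall n : nat,
    P s n \is monic /\ size (P s n) = n.+1 /\
    forall k : nat, (k < n)%N ->
      int0oo (fun x => (P s n).[x] * x ^+ k * weight alpha A B s x) = 0.

Definition normh {R : realType} (alpha A B : R) (P : R -> nat -> {poly R})
    (s : R) (n : nat) : R :=
  int0oo (fun x => ((P s n).[x]) ^+ 2 * weight alpha A B s x).

Definition Rn {R : realType} (alpha A B : R) (P : R -> nat -> {poly R})
    (s : R) (n : nat) : R :=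
  B * s `^ alpha * expR (- s) * ((P s n).[s]) ^+ 2 / normh alpha A B P s n.

Definition p1 {R : realType} (P : R -> nat -> {poly R}) (s : R) (n : nat) : R :=
  (P s n)`_(n.-1).

(* Main.v *)
(** The functional [L_s q = int q(x) w(x, s) dx] equals
    [A * tail q 0 + B * tail q s] with [tail q a = int_a^oo q(x) x^alpha e^-x dx],
    so [d/ds L_s q = - B s^alpha e^-s q(s)], and integrating the derivative of
    [x q(x) x^alpha e^-x] gives
    [L_s (x q' + (alpha + 1) q - x q) = - B s^(alpha + 1) e^-s q(s)].
    For [q = P_j^2], orthogonality turns this into
    [s R_j = p1(j) - p1(j+1) - 2 j - (alpha + 1)], which telescopes.
    For the logarithmic derivatives, the matrix of coefficients of the [P_j] is
    unitriangular and diagonalizes the Hankel matrix, whence [D_n = prod h_j],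
    and [h_j = D_(j+1) / D_j] is differentiable. As [h_j(s)] is the
    minimum of [L_s (q^2)] over monic [q] of degree [j], the function
    [L_s (P_j(., t)^2) - h_j(s)] of [s] is minimal at [s = t], which gives
    [h_j'(t) = - B t^alpha e^-t P_j(t, t)^2 = - R_j h_j]. *)
Require Import Defs.
From HB Require Import structures.
From mathcomp Require Import all_boot all_order all_algebra.
From mathcomp Require Import all_classical all_reals all_analysis.
From mathcomp Require Import measurable_realfun ring lra.
Set Implicit Arguments. Unset Strict Implicit. Unset Printing Implicit Defensive.
Import Order.TTheory GRing.Theory Num.Theory.
Import numFieldNormedType.Exports.
Local Open Scope ring_scope.

(** * Polynomials times the Laguerre weight: bounds, continuity, derivative *)

Section laguerre_tail.
Local Open Scope classical_set_scope.
Context {R : realType}.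
Notation mu := (@lebesgue_measure R).
Implicit Types (q : {poly R}) (a x : R).

(** Take [y <= 1 + y <= expR y] at [y = x / (2 * b)] and raise it to the power [b]. *)
Lemma powR_le_expR (b x : R) : 0 < b -> 0 <= x ->
  x `^ b <= (2 * b) `^ b * expR (x / 2).
Proof.
move=> b0 x0; have b20 : 0 < 2 * b by rewrite mulr_gt0.
have {1}-> : x = 2 * b * (x / (2 * b)) by rewrite mulrC divfK ?gt_eqF.
rewrite powRM ?divr_ge0 ?(ltW b20)//.
rewrite ler_wpM2l ?powR_ge0//.
have -> : x / 2 = x / (2 * b) * b by field; rewrite gt_eqF.
rewrite expRM ge0_ler_powR ?nnegrE ?expR_ge0 ?divr_ge0 ?(ltW b20) ?(ltW b0)//.
by rewrite (le_trans _ (expR_ge1Dx _))// lerDr.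
Qed.

Lemma cvgy_expR_half : expR (- x / 2) @[x --> +oo%R] --> (0 : R).
Proof.
rewrite (_ : (fun x : R => expR (- x / 2)) =
  (fun z => expR (- z)) \o (fun z => 2^-1 * z)); last first.
  by apply/funext => x /=; rewrite mulNr mulrC.
apply: (@cvg_comp _ _ _ _ _ _ (pinfty_nbhs R)); last exact: cvgr_expR.
exact: gt0_cvgMry.
Qed.

Lemma continuous_expRN : continuous (fun x : R => expR (- x)).
Proof.
move=> x; apply: (@continuous_comp _ _ _ (@GRing.opp R) expR).
  exact: opp_continuous.
exact: continuous_expR.
Qed.

Variable alpha : R.
Hypothesis alpha0 : 0 < alpha.

Definition laguerre (q : {poly R}) (x : R) : R :=
  q.[x] * (x `^ alpha * expR (- x)).

(** Each monomial uses up half of the exponential, by [powR_le_expR] with exponent [alpha + i]. The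
    bound gives both the limit at infinity and integrability. *)
Lemma laguerre_le_expR q : exists2 C, 0 <= C &
  forall x, 0 <= x -> `|laguerre q x| <= C * expR (- x / 2).
Proof.
pose b (i : nat) := alpha + i%:R.
have b0 i : 0 < b i by rewrite ltr_wpDr.
exists (\sum_(i < size q) `|q`_i| * (2 * b i) `^ (b i)).
  by apply: sumr_ge0 => i _; rewrite mulr_ge0// powR_ge0.
move=> x x0; rewrite /laguerre normrM.
rewrite [X in _ * X]ger0_norm ?mulr_ge0 ?powR_ge0 ?expR_ge0//.
have -> : expR (- x / 2) = expR (x / 2) * expR (- x).
  by rewrite -expRD; congr expR; field.
rewrite mulrA mulrA ler_wpM2r ?expR_ge0// horner_coef.
rewrite (le_trans (ler_wpM2r (powR_ge0 _ _) (ler_norm_sum _ _ _)))//.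
rewrite !mulr_suml; apply: ler_sum => i _.
rewrite normrM normrX (ger0_norm x0) -2!mulrA ler_wpM2l//.
rewrite -powR_mulrn// -powRD; last by rewrite addrC gt_eqF//; exact: b0.
rewrite addrC; apply: powR_le_expR => //; exact: b0.
Qed.

Lemma laguerre_continuous q x : 0 < x -> {for x, continuous (laguerre q)}.
Proof.
move=> x0; apply: cvgM; first apply: continuous_horner.
apply: cvgM.
  have : {for x, continuous (@powR R ^~ alpha)}.
    apply/differentiable_continuous/derivable1_diffP.
    by apply: derivable_powR; rewrite in_itv/= x0.
  exact.
exact: continuous_expRN.
Qed.

Lemma laguerre0 q : laguerre q 0 = 0.
Proof. by rewrite /laguerre powR0 ?gt_eqF// mul0r mulr0. Qed.

Lemma laguerre_within_continuous q a : 0 <= a ->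
  {within `[a, +oo[, continuous (laguerre q)}.
Proof.
move=> a0; suff : {within `[0, +oo[, continuous (laguerre q)}.
  by apply: continuous_subspaceW; apply: subset_itvr; rewrite bnd_simp.
apply/continuous_within_itvcyP; split.
  by move=> x; rewrite in_itv/= andbT; exact: laguerre_continuous.
(* At the left endpoint 0, the power of [x] tends to 0 because [alpha > 0]. *)
rewrite laguerre0 /laguerre -[X in _ --> X](mulr0 q.[0]).
apply: cvgM; first by apply: cvg_at_right_filter; apply: continuous_horner.
rewrite -[X in _ --> X](mul0r (expR (- 0))).
apply: cvgM; first exact: powR_cvg0.
apply: cvg_at_right_filter.
exact: continuous_expRN.
Qed.

Lemma cvgy_laguerre q : laguerre q x @[x --> +oo%R] --> (0 : R).
Proof.
have [C C0 qC] := laguerre_le_expR q.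
have cv0 : C * expR (- x / 2) @[x --> +oo%R] --> (0 : R).
  by rewrite -(mulr0 C); apply: cvgMr; exact: cvgy_expR_half.
apply: (@squeeze_cvgr _ _ _ _ (fun x => - (C * expR (- x / 2)))
   (fun x => C * expR (- x / 2))) => //; last first.
  by rewrite -oppr0; exact: cvgN.
near=> x; rewrite -ler_norml; apply: qC.
by near: x; exact: nbhs_pinfty_ge.
Unshelve. all: by end_near. Qed.

(** The factor ['X] absorbs the exponent [alpha - 1] of the differentiated power, so the derivative
    is again a polynomial times the weight. *)
Lemma is_derive_laguerre q x : 0 < x ->
  is_derive x 1 (laguerre ('X * q))
    (laguerre ('X * q^`() + (alpha + 1) *: q - 'X * q) x).
Proof.
move=> x0; rewrite /laguerre.
have dexp : is_derive x 1 (fun y => expR (- y)) (expR (- x) * -1).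
  exact: (@is_derive1_comp _ expR (@GRing.opp R)).
have dF := is_deriveM (is_derive_poly ('X * q) x)
  (is_deriveM (is_derive1_powR alpha x0) dexp).
apply: (is_derive_eq dF).
have xE : x `^ alpha = x * x `^ (alpha - 1) by rewrite mulr_powRB1// ltW.
rewrite derivM derivX mul1r !(hornerE, mulrfctE) /GRing.scale /= xE.
ring.
Qed.

Lemma measurable_laguerre q D : measurable_fun D (laguerre q).
Proof.
apply: measurable_funM.
  exact: measurable_poly.
apply: measurable_funM; first exact: measurable_funTS.
by apply: measurable_funTS; exact: measurableT_comp.
Qed.

(** * Integrability by comparison with [expR (- x / 2)] *)

Lemma is_derive_expR_half (x : R) :
  is_derive x 1 (fun y => - 2 * expR (- y / 2)) (expR (- x / 2)).
Proof.
have dh : is_derive x 1 (fun y : R => - y / 2) (- 2^-1).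
  by apply: is_derive_eq; rewrite /GRing.scale /=; ring.
have dexp : is_derive x 1 (fun y => expR (- y / 2)) (expR (- x / 2) * - 2^-1).
  exact: (@is_derive1_comp _ expR (fun y : R => - y / 2)).
by apply: is_derive_eq; rewrite /GRing.scale /=; field.
Qed.

Lemma continuous_expR_half : continuous (fun x : R => expR (- x / 2)).
Proof.
move=> x; apply: (@continuous_comp _ _ _ (fun y : R => - y / 2) expR).
  by apply: cvgMl; exact: opp_continuous.
exact: continuous_expR.
Qed.

Lemma integrable_expR_half : mu.-integrable `[0, +oo[
  (EFin \o (fun x : R => expR (- x / 2))).
Proof.
have cw : {within `[0, +oo[, continuous (fun x : R => expR (- x / 2))}.
  exact: (continuous_subspaceT continuous_expR_half).
have dF := is_derive_expR_half; have cexp := continuous_expR_half.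
apply/integrableP; split.
  apply/measurable_EFinP/measurable_funTS.
  exact: continuous_measurable_fun.
under eq_integral => x _ do rewrite /= ger0_norm ?expR_ge0//.
rewrite (@ge0_continuous_FTC2y _ _ (fun x => - 2 * expR (- x / 2)) _ 0)//.
- by rewrite -EFinB ltry.
- by rewrite -(mulr0 (- 2)); apply: cvgMr; exact: cvgy_expR_half.
- by apply: cvg_at_right_filter; apply: cvgMr; exact: cexp.
- by move=> x _; rewrite derive1E (@derive_val _ _ _ _ _ _ _ (dF x)).
Qed.

Lemma integrable_cst_expR_half C : mu.-integrable `[0, +oo[
  (EFin \o (fun x : R => C * expR (- x / 2))).
Proof.
rewrite (_ : _ \o _ = (fun x => C%:E * (expR (- x / 2))%:E)%E); last first.
  by apply/funext => x /=; rewrite EFinM.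
by apply: integrableZl => //; exact: integrable_expR_half.
Qed.

Lemma integrable_laguerre q : mu.-integrable `[0, +oo[ (EFin \o laguerre q).
Proof.
have [C C0 qC] := laguerre_le_expR q.
apply: (le_integrable _ _ _ (integrable_cst_expR_half C)) => //.
- apply/measurable_EFinP; exact: measurable_laguerre.
- move=> x /=; rewrite in_itv/= andbT => x0.
  by rewrite lee_fin (le_trans (qC _ x0))// ler_norm.
Qed.

(** * Tail integrals as functions of their lower endpoint *)

Definition tail (q : {poly R}) (a : R) : R :=
  \int[mu]_(x in `[a, +oo[) laguerre q x.

Lemma integrable_laguerre_ge q a : 0 <= a ->
  mu.-integrable `[a, +oo[ (EFin \o laguerre q).
Proof.
move=> a0; apply: (integrableS _ _ _ (integrable_laguerre q)) => //.
by apply: subset_itvr; rewrite bnd_simp.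
Qed.

Lemma tail_lin a c p q : 0 <= a -> tail (c *: p + q) a = c * tail p a + tail q a.
Proof.
move=> a0; rewrite /tail -RintegralZl//; last exact: integrable_laguerre_ge.
rewrite -RintegralD//; last 2 first.
- rewrite (_ : _ \o _ = (fun x => c%:E * (laguerre p x)%:E)%E); last first.
    by apply/funext => x /=; rewrite EFinM.
  by apply: integrableZl => //; exact: integrable_laguerre_ge.
- exact: integrable_laguerre_ge.
by apply: eq_Rintegral => x _; rewrite /laguerre hornerD hornerZ mulrDl -mulrA.
Qed.

(* The FTC on [a, +oo[ is only available for nonnegative integrands; adding a
   multiple of the primitive of [exp (- x / 2)] reduces to that case. *)
Lemma tail_by_parts q a : 0 <= a ->
  tail ('X * q^`() + (alpha + 1) *: q - 'X * q) a = - laguerre ('X * q) a.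
Proof.
move=> a0; set f := _ - _.
have [C C0 fC] := laguerre_le_expR f.
pose e (x : R) := C * expR (- x / 2).
pose E (x : R) := - 2 * C * expR (- x / 2).
have ie : mu.-integrable `[a, +oo[ (EFin \o e).
  apply: (integrableS _ _ _ (integrable_cst_expR_half C)) => //.
  by apply: subset_itvr; rewrite bnd_simp.
have dE (x : R) : is_derive x 1 E (e x).
  have -> : E = C \*: (fun y => - 2 * expR (- y / 2)).
    by apply/funext => y; rewrite -[RHS]/(C * (- 2 * expR (- y / 2))) /E; ring.
  exact: (is_deriveZ C (is_derive_expR_half x)).
have ce : continuous e by move=> x; apply: cvgMr; exact: continuous_expR_half.
have cE : continuous E by move=> x; apply: cvgMr; exact: continuous_expR_half.
have Ey : E x @[x --> +oo%R] --> (0 : R).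
  by rewrite -(mulr0 (- 2 * C)); apply: cvgMr; exact: cvgy_expR_half.
have intE : \int[mu]_(x in `[a, +oo[) e x = 0 - E a.
  apply: Rintegral_ge0_continuous_FTC2y => //.
  - by move=> x _; rewrite mulr_ge0 ?expR_ge0.
  - exact: continuous_subspaceT.
  - by apply: cvg_at_right_filter; exact: cE.
  - by move=> x _; rewrite derive1E (@derive_val _ _ _ _ _ _ _ (dE x)).
have dfE x : 0 < x ->
    is_derive x 1 (laguerre ('X * q) \+ E) (laguerre f x + e x).
  by move=> x0; apply: is_deriveD => //; exact: is_derive_laguerre.
have intfe : \int[mu]_(x in `[a, +oo[) (laguerre f x + e x) =
    0 - (laguerre ('X * q) a + E a).
  apply: (@Rintegral_ge0_continuous_FTC2y _ _ (laguerre ('X * q) \+ E)).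
  - move=> x ax; have := fC _ (le_trans a0 ax).
    by rewrite ler_norml /e => /andP[]; rewrite -subr_ge0 opprK.
  - move=> x; apply: cvgD; first exact: laguerre_within_continuous.
    exact: (continuous_subspaceT ce).
  - by rewrite -(addr0 0); apply: cvgD => //; exact: cvgy_laguerre.
  - by move=> x ax; exact: (@ex_derive _ _ _ _ _ _ _ (dfE x (le_lt_trans a0 ax))).
  - apply: cvgD; last by apply: cvg_at_right_filter; exact: cE.
    by have /continuous_within_itvcyP[] := @laguerre_within_continuous ('X * q) a a0.
  - move=> x; rewrite in_itv/= andbT => ax.
    by rewrite derive1E (@derive_val _ _ _ _ _ _ _ (dfE x (le_lt_trans a0 ax))).
move: intfe; rewrite RintegralD//; last exact: integrable_laguerre_ge.
by rewrite intE /tail => h; lra.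
Qed.

Lemma tailB q a b : 0 <= a -> a <= b ->
  tail q b = tail q a - \int[mu]_(x in `[a, b]) laguerre q x.
Proof.
move=> a0 ab.
rewrite /tail (@Rintegral_itvB _ _ _ _ b)//; last exact: integrable_laguerre_ge.
rewrite Rintegral_itv_obnd_cbnd//.
apply: (integrableS _ _ _ (integrable_laguerre_ge q a0)) => //.
by apply: subset_itvr; rewrite bnd_simp.
Qed.

(** Near [a] the tail is the constant [tail q 0] minus the integral over [[0, y]], to which the
    fundamental theorem applies. *)
Lemma is_derive_tail q a : 0 < a -> is_derive a 1 (tail q) (- laguerre q a).
Proof.
move=> a0.
pose F y := \int[mu]_(x in `[0, y]) laguerre q x.
have [dF F'] : derivable F a 1 /\ F^`() a = laguerre q a.
  apply: (@continuous_FTC1_closed _ _ _ _ (a + 1)) => //.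
  - by rewrite ltrDl.
  - apply: (integrableS _ _ _ (integrable_laguerre q)) => //.
    exact: subset_itvl.
  - exact: laguerre_continuous.
have iF : is_derive a 1 F (laguerre q a) by split => //; rewrite -derive1E.
apply: (@near_eq_is_derive _ _ _ (fun y => tail q 0 - F y)).
  by near=> y; rewrite -tailB//; apply: ltW; near: y; exact: lt_nbhsr.
by rewrite -(add0r (- _)); apply: is_deriveB.
Unshelve. all: by end_near. Qed.

Lemma tail_ge0 q a : (forall x, 0 <= x -> 0 <= q.[x]) -> 0 <= a -> 0 <= tail q a.
Proof.
move=> q0 a0; apply: Rintegral_ge0 => x; rewrite /= in_itv/= andbT => ax.
by rewrite /laguerre !mulr_ge0 ?powR_ge0 ?expR_ge0 ?q0 ?(le_trans a0).
Qed.

(* If [tail q a = 0], then [tail q] vanishes beyond [a], hence so does its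
   derivative. *)
Lemma tail_gt0 q a : q != 0 -> (forall x, 0 <= x -> 0 <= q.[x]) ->
  0 <= a -> 0 < tail q a.
Proof.
move=> q0 q_ge0 a0; rewrite lt_neqAle tail_ge0// andbT.
apply/negP => /eqP tq0.
have tq x : a < x -> tail q x = 0.
  move=> ax; apply/eqP; rewrite eq_le tail_ge0 ?andbT//; last first.
    by rewrite ltW// (le_lt_trans a0).
  rewrite (@tailB q a)// ?(ltW ax)// -tq0 sub0r oppr_le0.
  apply: Rintegral_ge0 => y; rewrite /= in_itv/= => /andP[ay _].
  by rewrite /laguerre !mulr_ge0 ?powR_ge0 ?expR_ge0 ?q_ge0 ?(le_trans a0).
have rootq x : a < x -> root q x.
  move=> ax; have x0 : 0 < x by exact: le_lt_trans ax.
  have d0 : is_derive x 1 (tail q) 0.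
    apply: (@near_eq_is_derive _ _ _ (fun=> 0)) => //.
    by near=> y; rewrite tq//; near: y; exact: lt_nbhsr.
  have := is_derive_tail q x0.
  move=> /(@derive_val _ _ _ _ _ _ _).
  rewrite (@derive_val _ _ _ _ _ _ _ d0) => /esym/eqP.
  have w0 : x `^ alpha * expR (- x) != 0.
    by rewrite mulf_neq0// gt_eqF// ?powR_gt0// expR_gt0.
  by rewrite oppr_eq0 /laguerre mulf_eq0 (negPf w0) orbF.
(* A nonzero [q] has fewer than [size q] roots, yet [a + 1], ..., [a + size q] are [size q] distinct
   ones. *)
have := @max_poly_roots _ q [seq a + i%:R | i <- iota 1 (size q)] q0.
rewrite size_map size_iota ltnn => h; suff : false by []; apply: h.
- apply/allP => _ /mapP[i + ->]; rewrite mem_iota => /andP[i0 _].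
  by apply: rootq; rewrite ltrDl ltr0n.
- rewrite map_inj_uniq ?iota_uniq// => i j /addrI/eqP.
  by rewrite eqr_nat => /eqP.
Unshelve. all: by end_near. Qed.

End laguerre_tail.

(** * Orthogonal polynomials for an abstract linear functional *)

Section orthogonal_polynomials.
Context {R : comNzRingType} (L : {scalar {poly R}}) (P : nat -> {poly R}).
Hypothesis P_monic : forall n, P n \is monic.
Hypothesis P_size : forall n, size (P n) = n.+1.
Hypothesis P_orth : forall n k, (k < n)%N -> L (P n * 'X^k) = 0.

Implicit Types q : {poly R}.

Lemma orth_low n q : (size q <= n)%N -> L (P n * q) = 0.
Proof.
move=> qn; rewrite -(coefK q) poly_def mulr_sumr linear_sum big1// => i _.
by rewrite /= -scalerAr linearZ /= P_orth ?mulr0// (leq_trans _ qn).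
Qed.

Lemma orthogonal m n : m != n -> L (P m * P n) = 0.
Proof.
rewrite neq_ltn => /orP[mn|nm]; last by rewrite orth_low ?P_size.
by rewrite mulrC orth_low ?P_size.
Qed.

Lemma det_hankel n :
  \det (\matrix_(i < n, j < n) L 'X^(i + j)) = \prod_(j < n) L (P j ^+ 2).
Proof.
pose C : 'M[R]_n := \matrix_(i, j) (P i)`_j.
pose H : 'M[R]_n := \matrix_(i < n, j < n) L 'X^(i + j).
have PE (i : 'I_n) : P i = \sum_(k < n) C i k *: 'X^k.
  rewrite [LHS](_ : _ = \poly_(k < n) (P i)`_k).
    by rewrite poly_def; apply: eq_bigr => k _; rewrite mxE.
  apply/polyP => k; rewrite coef_poly; case: ltnP => // nk.
  by rewrite nth_default// P_size (leq_trans _ nk).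
have detC : \det C = 1.
  rewrite det_trig.
    by rewrite big1// => i _; rewrite mxE -(monicP (P_monic i)) lead_coefE P_size.
  apply/is_trig_mxP => i j ij; rewrite mxE nth_default// P_size.
  exact: ij.
(* Congruence by [C] turns the Hankel matrix into the Gram matrix of the [P i], which is diagonal by
   orthogonality. *)
have CHC : C *m H *m C^T = diag_mx (\row_j L (P j ^+ 2)).
  apply/matrixP => i j; rewrite !mxE.
  transitivity (L (P i * P j)).
    rewrite (PE i) (PE j) mulr_suml linear_sum/=.
    under eq_bigr => k _ do rewrite !mxE mulr_suml.
    rewrite exchange_big/=; apply: eq_bigr => k _.
    rewrite mulr_sumr linear_sum/=; apply: eq_bigr => l _.
    by rewrite !mxE -scalerAl -scalerAr -exprD !linearZ/= mulrAC mulrA.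
  have [->|ij] := eqVneq i j; first by rewrite expr2 mulr1n.
  by rewrite mulr0n orthogonal.
have := congr1 determinant CHC.
rewrite !det_mulmx det_tr detC mulr1 mul1r det_diag => ->.
by apply: eq_bigr => j _; rewrite mxE.
Qed.

(** Pythagoras: both polynomials are monic of degree [n], so [q - P n] has lower degree and is
    orthogonal to [P n]. This is the source of the minimality of the norms. *)
Lemma monic_sqr n q : q \is monic -> size q = n.+1 ->
  L (q ^+ 2) = L (P n ^+ 2) + L ((q - P n) ^+ 2).
Proof.
move=> qm qs; set r := q - P n.
have rn : (size r <= n)%N.
  apply/leq_sizeP => j; rewrite leq_eqVlt => /predU1P[<-|nj].
    have := monicP qm; have := monicP (P_monic n).
    by rewrite !lead_coefE qs P_size/= coefB => -> ->; rewrite subrr.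
  by rewrite coefB !nth_default ?subrr// ?qs ?P_size.
have -> : q = P n + r by rewrite /r addrC subrK.
by rewrite sqrrD mulr2n !linearD /= !(orth_low rn) !addr0.
Qed.

(* Differs from [p1] at [n = 0], where [p1] is the leading coefficient [1]; the
   three-term recurrence needs [0] there. *)
Definition subcoef n := if n is m.+1 then (P n)`_m else 0.

(** [a] is the diagonal coefficient of the three-term recurrence: subtracting [P n.+1] and
    [a *: P n] from ['X * P n] cancels degrees [n.+1] and [n], and the rest is orthogonal to
    [P n]. *)
Lemma scalar_mulX_sqr n :
  L ('X * P n ^+ 2) = (subcoef n - subcoef n.+1) * L (P n ^+ 2).
Proof.
set a := _ - _; pose r := 'X * P n - P n.+1 - a *: P n.
have top m : (P m)`_m = 1.
  by rewrite -(monicP (P_monic m)) lead_coefE P_size.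
have rn : (size r <= n)%N.
  apply/leq_sizeP => j; rewrite !coefB coefZ coefXM.
  rewrite leq_eqVlt => /predU1P[<-|].
    (* For [n = 0] the product ['X * P n] has no constant term, which matches [subcoef 0 = 0]. *)
    rewrite top mulr1 /a; case: n @a @r => [|n] a r /=; ring.
  rewrite leq_eqVlt => /predU1P[<-|nj].
    by rewrite /= !top [(P n)`_n.+1]nth_default ?P_size//; ring.
  case: j nj => // j nj /=; rewrite !nth_default ?P_size ?mulr0 ?subrr//.
  exact: ltnW.
have -> : 'X * P n ^+ 2 = P n * r + P n * P n.+1 + a *: P n ^+ 2.
  by rewrite /r mulrBr mulrBr -scalerAr expr2 mulrCA; ring.
rewrite !linearD linearZ/= orth_low// orthogonal ?add0r//.
by rewrite neq_ltn ltnSn.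
Qed.

(** Multiplying the derivative of [P n] by ['X] gives a polynomial that agrees with [n%:R *: P n] in
    degree [n]; the difference is orthogonal to [P n]. *)
Lemma scalar_Xderiv_sqr n :
  L ('X * (P n ^+ 2)^`()) = 2 * n%:R * L (P n ^+ 2).
Proof.
pose r := 'X * (P n)^`() - n%:R *: P n.
have rn : (size r <= n)%N.
  apply/leq_sizeP => j; rewrite coefB coefZ coefXM coef_deriv.
  case: j => [|j] /=; first by rewrite leqn0 => /eqP ->; rewrite mul0r subrr.
  rewrite leq_eqVlt => /predU1P[->|nj]; first by rewrite mulr_natl subrr.
  by rewrite !nth_default ?P_size ?mul0rn ?mulr0 ?subrr.
have -> : 'X * (P n ^+ 2)^`() = 2%:R *: (P n * r) + (2 * n%:R) *: P n ^+ 2.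
  rewrite /r mulrBr -scalerAr scalerBr scalerA subrK.
  by rewrite expr2 derivM scaler_nat; ring.
by rewrite linearD !linearZ/= orth_low// mulr0 add0r.
Qed.

End orthogonal_polynomials.

(** * Differentiability of sums, products and determinants *)

Section derivable_big.
Context {R : realType}.

Lemma derivable_big_sum I (r : seq I) (F : I -> R -> R) x :
  (forall i, derivable (F i) x 1) ->
  derivable (fun s => \sum_(i <- r) F i s) x 1.
Proof.
move=> dF; elim: r => [|i r ih].
  by under eq_fun do rewrite big_nil; exact: derivable_cst.
by under eq_fun do rewrite big_cons; exact: derivableD.
Qed.

Lemma derivable_big_prod I (r : seq I) (F : I -> R -> R) x :
  (forall i, derivable (F i) x 1) ->
  derivable (fun s => \prod_(i <- r) F i s) x 1.
Proof.
move=> dF; elim: r => [|i r ih].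
  by under eq_fun do rewrite big_nil; exact: derivable_cst.
by under eq_fun do rewrite big_cons; exact: derivableM.
Qed.

Lemma derivable_det n (M : R -> 'M[R]_n) x :
  (forall i j, derivable (fun s => M s i j) x 1) ->
  derivable (fun s => \det (M s)) x 1.
Proof.
(* [\det] unfolds to the Leibniz sum over permutations [sg]. *)
move=> dM; apply: derivable_big_sum => sg.
apply: derivableM; first exact: derivable_cst.
by apply: derivable_big_prod => i; exact: dM.
Qed.

End derivable_big.

(** * The functional of the weight and its dependence on [s] *)

Section weight_functional.
Local Open Scope classical_set_scope.
Context {R : realType} (alpha A B : R).
Notation mu := (@lebesgue_measure R).
Hypothesis alpha0 : 0 < alpha.
Implicit Types (s x : R) (q : {poly R}).

(** In this form of the integral against the weight, [s] occurs only as an endpoint of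
    integration. *)
Definition functional s q : R := A * tail alpha q 0 + B * tail alpha q s.

(** [heaviside (x - s)] is the indicator of the open ray [S], and closing the ray at [s] does not
    change the integral. *)
Lemma int0oo_weight s q : 0 <= s ->
  int0oo (fun x => q.[x] * weight alpha A B s x) = functional s q.
Proof.
move=> s0; pose S := `]s, +oo[%classic : set R.
have -> : (fun x => q.[x] * weight alpha A B s x) =
    (fun x => A * laguerre alpha q x + B * (laguerre alpha q \_ S) x).
  apply/funext => x; rewrite /weight /heaviside /laguerre patchE.
  rewrite mem_setE in_itv/= andbT subr_gt0.
  (* Off [S] the restriction takes the default value [point], which is 0 in [R]. *)
  by rewrite (_ : point = 0 :> R)//; case: ifP => _; ring.
have sS : S `<=` `[0%R, +oo[ by rewrite /S; apply: subset_itvr; rewrite bnd_simp.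
have setIS : `[0%R, +oo[ `&` S = S by exact: setIidr.
have iq := integrable_laguerre alpha0 q.
have iqS : mu.-integrable S (EFin \o laguerre alpha q).
  by rewrite /S; apply: (integrableS _ _ _ iq).
have iS : mu.-integrable `[0%R, +oo[ (EFin \o (laguerre alpha q \_ S)).
  rewrite -restrict_EFin; apply/integrable_restrict; [exact: measurable_itv..|].
  by rewrite setIS.
have iZ (c : R) (f : R -> R) : mu.-integrable `[0%R, +oo[ (EFin \o f) ->
    mu.-integrable `[0%R, +oo[ (EFin \o (fun x => c * f x)).
  move=> jf; rewrite (_ : _ \o _ = (fun x => c%:E * (f x)%:E)%E).
    exact: integrableZl.
  by apply/funext => x /=; rewrite EFinM.
rewrite /int0oo RintegralD// ?RintegralZl//; last 2 first.
- exact: iZ.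
- exact: iZ.
by rewrite -Rintegral_mkcondr setIS Rintegral_itv_obnd_cbnd.
Qed.

Lemma functional_linear s : 0 <= s -> linear_for *%R (functional s).
Proof.
move=> s0 c p q; rewrite /functional !tail_lin//; ring.
Qed.

Lemma is_derive_functional q s : 0 < s ->
  is_derive s 1 (functional ^~ q) (- (B * laguerre alpha q s)).
Proof.
move=> s0; rewrite -mulrN -[X in is_derive _ _ _ X]add0r.
apply: is_deriveD.
exact: (is_deriveZ B (is_derive_tail alpha0 q s0)).
Qed.

(** Both tails are integrated by parts; the boundary term at 0 vanishes and the one at [s]
    remains. *)
Lemma functional_by_parts q s : 0 <= s ->
  functional s ('X * q^`() + (alpha + 1) *: q - 'X * q) =
  - (B * laguerre alpha ('X * q) s).
Proof.
move=> s0; rewrite /functional !tail_by_parts// laguerre0//.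
by rewrite oppr0 mulr0 add0r mulrN.
Qed.

Hypotheses (A0 : 0 <= A) (B0 : 0 < B).

(** Strictness comes from the [B] term, as [A] may be 0. *)
Lemma functional_sqr_gt0 q s : q != 0 -> 0 <= s -> 0 < functional s (q ^+ 2).
Proof.
move=> q0 s0; have q20 x : 0 <= x -> 0 <= (q ^+ 2).[x].
  by rewrite horner_exp sqr_ge0.
rewrite ltr_wpDl ?mulr_ge0 ?tail_ge0//.
by rewrite mulr_gt0 ?tail_gt0// expf_neq0.
Qed.

Lemma functional_sqr_ge0 q s : 0 <= s -> 0 <= functional s (q ^+ 2).
Proof.
move=> s0; have q20 x : 0 <= x -> 0 <= (q ^+ 2).[x].
  by rewrite horner_exp sqr_ge0.
by rewrite addr_ge0 ?mulr_ge0 ?tail_ge0// ltW.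
Qed.

End weight_functional.

(** * Norms, Hankel determinants and [Rn] at a fixed [s] *)

Section fixed_parameter.
Context {R : realType} (alpha A B s : R) (P : R -> nat -> {poly R}).
Hypotheses (alpha0 : 0 < alpha) (A0 : 0 <= A) (B0 : 0 < B) (s0 : 0 < s).
Hypothesis P_orth : monic_orthogonal_family alpha A B P.

Notation L := (functional alpha A B s).

(** Linearity rests on the integrability of both tails, shown for [0 <= s], so the instance is
    declared at a fixed positive [s]. [L_lin] is the bundled form taken by the lemmas on abstract
    functionals. *)
HB.instance Definition _ := GRing.isLinear.Build R {poly R} R *%R L
  (functional_linear A B alpha0 (ltW s0)).

Let L_lin : {scalar {poly R}} := L.

Let P_monic n : P s n \is monic.
Proof. by case: (P_orth s0 n). Qed.

Let P_size n : size (P s n) = n.+1.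
Proof. by case: (P_orth s0 n) => _ []. Qed.

Let L_orth n k : (k < n)%N -> L (P s n * 'X^k) = 0.
Proof.
case: (P_orth s0 n) => _ [_ /(_ k)] + kn => /(_ kn) <-.
rewrite -int0oo_weight ?ltW//; apply: eq_Rintegral => x _.
by rewrite hornerM hornerXn.
Qed.

Lemma moment_functional k : moment alpha A B s k = L 'X^k.
Proof.
rewrite -int0oo_weight ?ltW//; apply: eq_Rintegral => x _.
by rewrite hornerXn.
Qed.

Lemma normh_functional n : normh alpha A B P s n = L (P s n ^+ 2).
Proof.
rewrite -int0oo_weight ?ltW//; apply: eq_Rintegral => x _.
by rewrite horner_exp.
Qed.

Lemma hankelD_prod n :
  hankelD alpha A B s n = \prod_(j < n) normh alpha A B P s j.
Proof.
under eq_bigr do rewrite normh_functional.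
rewrite -(det_hankel (L := L_lin) P_monic P_size L_orth).
congr (\det _); apply/matrixP => i j; rewrite !mxE.
exact: moment_functional.
Qed.

Lemma normh_gt0 n : 0 < normh alpha A B P s n.
Proof.
rewrite normh_functional.
by apply: functional_sqr_gt0 => //; [exact: monic_neq0|exact: ltW].
Qed.

Lemma normh_min n q : q \is monic -> size q = n.+1 ->
  normh alpha A B P s n <= L (q ^+ 2).
Proof.
move=> qm qn; rewrite normh_functional.
rewrite (monic_sqr (L := L_lin) P_monic P_size L_orth qm qn).
by rewrite lerDl; apply: functional_sqr_ge0 => //; exact: ltW.
Qed.

Lemma mul_Rn n : s * Rn alpha A B P s n =
  subcoef (P s) n - subcoef (P s) n.+1 - 2 * n%:R - (alpha + 1).
Proof.
have h0 : normh alpha A B P s n != 0 by rewrite gt_eqF ?normh_gt0.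
apply: (mulIf h0).
(* The left side becomes [h_n] times [2 n + alpha + 1 - (subcoef n - subcoef n.+1)]; the boundary
   term is [- s R_n h_n]. *)
have := functional_by_parts A B alpha0 (P s n ^+ 2) (ltW s0).
rewrite linearB linearD linearZ/=.
rewrite (scalar_Xderiv_sqr (L := L_lin) P_size L_orth).
rewrite (scalar_mulX_sqr (L := L_lin) P_monic P_size L_orth).
rewrite -[functional _ _ _ _ _]normh_functional.
have -> : s * Rn alpha A B P s n * normh alpha A B P s n =
    B * laguerre alpha ('X * P s n ^+ 2) s.
  rewrite /Rn /laguerre hornerM hornerX horner_exp.
  by rewrite mulrA divfK//; ring.
rewrite /L_lin /= -normh_functional => /(congr1 (@GRing.opp R)).
by rewrite opprK => <-; ring.
Qed.

(** The sum telescopes from [subcoef 0 = 0], and the terms [2 j + alpha + 1] add up to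
    [n (n + alpha)]. *)
Lemma sum_mul_Rn n : s * \sum_(j < n) Rn alpha A B P s j =
  - subcoef (P s) n - n%:R * (n%:R + alpha).
Proof.
elim: n => [|n ih]; first by rewrite big_ord0 /= !(mulr0, mul0r, subr0, oppr0).
by rewrite big_ord_recr mulrDr ih mul_Rn -natr1; ring.
Qed.

End fixed_parameter.

(** * Derivatives with respect to the jump position *)

Section derivatives.
Context {R : realType} (alpha A B : R) (P : R -> nat -> {poly R}).
Hypotheses (alpha0 : 0 < alpha) (A0 : 0 <= A) (B0 : 0 < B).
Hypothesis P_orth : monic_orthogonal_family alpha A B P.

Implicit Types s t : R.

Notation D := (hankelD alpha A B).
Notation h := (normh alpha A B P).
Notation L := (functional alpha A B).

Lemma derivable_hankelD n t : 0 < t -> derivable (D ^~ n) t 1.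
Proof.
move=> t0; apply: derivable_det => i j.
apply: (@near_eq_derivable _ _ _ (fun s => L s 'X^(i + j))).
  near=> s; rewrite mxE moment_functional//.
  by near: s; exact: lt_nbhsr.
exact: (@ex_derive _ _ _ _ _ _ _ (is_derive_functional A B alpha0 'X^(i + j) t0)).
Unshelve. all: by end_near. Qed.

(** The quotient [D_(n+1) / D_n] involves only moments, whose derivatives are known, and not the
    coefficients of [P s n]. *)
Lemma derivable_normh n t : 0 < t -> derivable (h ^~ n) t 1.
Proof.
move=> t0; apply: (@near_eq_derivable _ _ _ (fun s => D s n.+1 * (D s n)^-1)).
  near=> s; have s0 : 0 < s by near: s; exact: lt_nbhsr.
  rewrite !(hankelD_prod alpha0 s0 P_orth) big_ord_recr/= mulrAC mulfV ?mul1r//.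
  by apply/prodf_neq0 => i _; rewrite gt_eqF// normh_gt0.
apply: derivableM; first exact: derivable_hankelD.
apply: derivableV; last exact: derivable_hankelD.
rewrite (hankelD_prod alpha0 t0 P_orth).
by apply/prodf_neq0 => i _; rewrite gt_eqF// normh_gt0.
Unshelve. all: by end_near. Qed.

(* Envelope argument: [h s n <= L s (P t n ^+ 2)] with equality at [s = t], so
   both sides have the same derivative at [t] and that of [s |-> P s n] is not
   needed. *)
Lemma is_derive_normh n t : 0 < t ->
  is_derive t 1 (h ^~ n) (- (B * laguerre alpha (P t n ^+ 2) t)).
Proof.
move=> t0; have [Pm [Ps _]] := P_orth t0 n.
have dL s : 0 < s -> derivable (L ^~ (P t n ^+ 2)) s 1.
  move=> s0.
  exact: (@ex_derive _ _ _ _ _ _ _ (is_derive_functional A B alpha0 _ s0)).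
have dphi : is_derive t 1 (fun s => L s (P t n ^+ 2) - h s n) 0.
  (* The interval []0, t + 1[] contains [t] in its interior and only positive points. *)
  apply: (@derive1_at_min _ _ 0 (t + 1)).
  - by rewrite addr_ge0// ltW.
  - move=> s; rewrite in_itv/= => /andP[s0 _].
    by apply: derivableB; [exact: dL|exact: derivable_normh].
  - by rewrite in_itv/= t0 ltrDl ltr01.
  - move=> s; rewrite in_itv/= => /andP[s0 _].
    by rewrite -normh_functional// subrr subr_ge0 normh_min.
have := is_deriveB (is_derive_functional A B alpha0 (P t n ^+ 2) t0) dphi.
rewrite subr0; congr is_derive.
by apply/funext => s; rewrite -[LHS]/(_ - (_ - _)) opprB addrC subrK.
Qed.

Lemma is_derive_ln_normh n t : 0 < t ->
  is_derive t 1 (fun s => ln (h s n)) (- Rn alpha A B P t n).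
Proof.
move=> t0; have h0 : 0 < h t n by exact: normh_gt0.
have := is_derive1_comp (is_derive1_ln h0) (is_derive_normh n t0).
congr is_derive; rewrite /Rn /laguerre horner_exp.
by rewrite mulrN mulrC; congr (- (_ / _)); ring.
Qed.

Lemma is_derive_ln_hankelD n t : 0 < t ->
  is_derive t 1 (fun s => ln (D s n)) (- \sum_(j < n) Rn alpha A B P t j).
Proof.
move=> t0; rewrite -sumrN.
have := @is_derive_sum _ _ _ _ _ _ _ _
  (fun j : 'I_n => is_derive_ln_normh j t0).
(* The product formula and the positivity of the norms hold for [s > 0], so the two functions are
   compared only near [t]. *)
apply: near_eq_is_derive; near=> s.
have s0 : 0 < s by near: s; exact: lt_nbhsr.
rewrite (hankelD_prod alpha0 s0 P_orth) fct_sumE.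
elim: n => [|n ih]; first by rewrite !big_ord0 ln1.
rewrite !big_ord_recr/= ih lnM// posrE ?normh_gt0//.
by apply: prodr_gt0 => i _; exact: normh_gt0.
Unshelve. all: by end_near. Qed.

End derivatives.

(** * The chain of equalities for the logarithmic derivative of [D_n] *)

Theorem theorem3 (R : realType) (alpha A B t : R) (P : R -> nat -> {poly R})
  (n : nat) :
  0 < alpha -> 0 <= A -> 0 < B -> 0 < t ->
  monic_orthogonal_family alpha A B P ->
  (1 <= n)%N ->
  hankelD alpha A B t n = \prod_(j < n) normh alpha A B P t j /\
  derivable (fun s => ln (hankelD alpha A B s n)) t 1 /\
  (forall j : nat, (j < n)%N -> derivable (fun s => ln (normh alpha A B P s j)) t 1) /\
  - t * derive1 (fun s => ln (hankelD alpha A B s n)) t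
    = - t * \sum_(j < n) derive1 (fun s => ln (normh alpha A B P s j)) t /\
  - t * \sum_(j < n) derive1 (fun s => ln (normh alpha A B P s j)) t
    = t * \sum_(j < n) Rn alpha A B P t j /\
  t * \sum_(j < n) Rn alpha A B P t j = - p1 P t n - n%:R * (n%:R + alpha).
Proof.
move=> alpha0 A0 B0 t0 P_orth n1.
have dD := is_derive_ln_hankelD alpha0 A0 B0 P_orth n t0.
have dh j := is_derive_ln_normh alpha0 A0 B0 P_orth j t0.
have sumE : \sum_(j < n) derive1 (fun s => ln (normh alpha A B P s j)) t =
    - \sum_(j < n) Rn alpha A B P t j.
  rewrite -sumrN; apply: eq_bigr => j _.
  by rewrite derive1E (@derive_val _ _ _ _ _ _ _ (dh j)).
split; first exact: hankelD_prod.
split; first exact: (@ex_derive _ _ _ _ _ _ _ dD).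
split; first by move=> j _; exact: (@ex_derive _ _ _ _ _ _ _ (dh j)).
split; first by rewrite sumE derive1E (@derive_val _ _ _ _ _ _ _ dD).
split; first by rewrite sumE mulrNN.
(* For [n = m.+1] both [subcoef] and [p1] are the coefficient of index [m]; [1 <= n] rules out 0,
   where they differ. *)
by rewrite (sum_mul_Rn alpha0 A0 B0 t0 P_orth); case: n n1 {dD sumE}.
Qed.
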